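(* Let $n\ge 2$ be an integer, let $F$ be a probability distribution on $\mathbb{R}$ that is $n$-completely mixable with center $\mu\in\mathbb{R}$, let $X\in L^0$ with $X\sim F$, and let $\|\cdot\|$ be any law-determined norm on $L^0$. Then $$\|(X-t)_+\|\le(n-1)\,\|(X-s)_-\|\quad\text{and}\quad\|(X-t)_-\|\le(n-1)\,\|(X-s)_+\|$$ for all $t\in\mathbb{R}$ and $s=(n\mu-t)/(n-1)$.
   Context: $(\Omega,\mathcal{A},\mathbb{P})$ is an atomless probability space and $L^0$ is the set of all real-valued random variables on it. $X\sim F$ means $X$ has distribution $F$, and $X\overset{d}{=}Y$ means equality in distribution. $(x)_+=\max\{x,0\}$ and $(x)_-=-\min\{x,0\}$. A distribution $F$ on $\mathbb{R}$ is $n$-completely mixable with center $\mu$ if there exist random variables $X_1,\dots,X_n\in L^0$, each with distribution $F$, such that $X_1+\dots+X_n=n\mu$ almost surely. A law-determined norm $\|\cdot\|$ on $L^0$ is a map $L^0\to[0,\infty]$ (the value $\infty$ is allowed) such that (i) $\|aX\|=|a|\cdot\|X\|$ for $a\in\mathbb{R}$, $X\in L^0$ (with $0\cdot\infty=0$); (ii) $\|X+Y\|\le\|X\|+\|Y\|$ for $X,Y\in L^0$; (iii) $\|X\|=0$ implies $X=0$ almost surely; (iv) $\|X\|=\|Y\|$ if $X\overset{d}{=}Y$, $X,Y\in L^0$; (v) $\|X\|\le\|Y\|$ if $0\le X\le Y$ almost surely. *)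

(* Defs.v *)
From HB Require Import structures.
From mathcomp Require Import all_boot all_order all_algebra.
From mathcomp Require Import all_classical all_reals all_analysis.
From mathcomp Require Import measurable_realfun.

Set Implicit Arguments.
Unset Strict Implicit.
Unset Printing Implicit Defensive.

Import Order.TTheory GRing.Theory Num.Theory.
Import numFieldNormedType.Exports.

Local Open Scope classical_set_scope.
Local Open Scope ring_scope.

Section definitions.
Context {d : measure_display} {T : measurableType d} {R : realType}.
Variable P : probability T R.

Definition is_atom (A : set T) : Prop :=
  [/\ measurable A, (0 < P A)%E &
    forall B, measurable B -> B `<=` A -> P B = 0%E \/ P B = P A].

Definition atomless : Prop := forall A, ~ is_atom A.

(* Set functions of the library are also defined, without any meaning, on
   nonmeasurable sets, so laws are compared on measurable sets only. *)
Definition has_law (X : {RV P >-> R})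
    (F : probability (measurableTypeR R) R) : Prop :=
  forall A, measurable A -> distribution P X A = F A.

Definition eq_law (X Y : {RV P >-> R}) : Prop :=
  forall A, measurable A -> distribution P X A = distribution P Y A.

Definition completely_mixable (n : nat)
    (F : probability (measurableTypeR R) R) (mu : R) : Prop :=
  exists X : 'I_n -> {RV P >-> R},
    (forall i, has_law (X i) F) /\
    {ae P, forall w, \sum_(i < n) X i w = n%:R * mu}.

(* An element of {RV P >-> R} is a measurable function on T, not a class
   modulo almost sure equality; ldn_law makes N well defined on classes.
   The convention 0 * oo = 0 in homogeneity is that of mule.  *)
Record law_determined_norm (N : {RV P >-> R} -> \bar R) : Prop := {
  ldn_ge0 : forall X : {RV P >-> R}, (0 <= N X)%E ;
  ldn_homogeneous : forall (a : R) (X : {RV P >-> R}),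
    N (cst a \* X) = (`|a|%:E * N X)%E ;
  ldn_triangle : forall X Y : {RV P >-> R},
    (N (X \+ Y)%R <= N X + N Y)%E ;
  ldn_definite : forall X : {RV P >-> R},
    N X = 0%E -> {ae P, forall w, X w = 0} ;
  ldn_law : forall X Y : {RV P >-> R}, eq_law X Y -> N X = N Y ;
  ldn_monotone : forall X Y : {RV P >-> R},
    {ae P, forall w, 0 <= X w <= Y w} -> (N X <= N Y)%E }.

End definitions.

(* Main.v *)
Require Import Defs.
From HB Require Import structures.
From mathcomp Require Import all_boot all_order all_algebra.
From mathcomp Require Import all_classical all_reals all_analysis.
From mathcomp Require Import measurable_realfun.
From mathcomp Require Import ring.

(** Take X_0, ..., X_(n-1) with law F and constant sum n mu.  The value of s is
    the one for which the constant sum reads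
      X_0 - t = sum over the n - 1 indices i > 0 of (s - X_i),
    so subadditivity of the positive part bounds (X_0 - t)_+ by the sum of the
    (X_i - s)_-.  Monotonicity and the triangle inequality carry this bound to
    norms, and there every term depends on the law F only, so that X may
    replace all the X_i and the n - 1 summands become equal.  The second
    inequality is the same argument with the signs exchanged.

    [ldn_completely_mixable] is the probabilistic part: a pointwise inequality
    on the hyperplane of constant sum becomes an inequality of norms.  The
    pointwise inequalities come from [sum_const_subE], the rewritten sum, and
    from [max0_sum], the subadditivity. *)

Import Order.TTheory GRing.Theory Num.Theory.
Import numFieldNormedType.Exports.

Local Open Scope classical_set_scope.
Local Open Scope ring_scope.

Lemma eq_law_comp {d : measure_display} {T : measurableType d} {R : realType}
    {P : probability T R} {g : R -> R} {X Y gX gY : {RV P >-> R}} :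
  measurable_fun setT g -> eq_law X Y ->
  gX =1 g \o X -> gY =1 g \o Y -> eq_law gX gY.
Proof.
move=> mg XY gXE gYE A mA.
have lawE (Z gZ : {RV P >-> R}) : gZ =1 g \o Z ->
    distribution P gZ A = distribution P Z (g @^-1` A).
  by move=> /funext gZE; rewrite /distribution /pushforward gZE.
rewrite (lawE X)// (lawE Y)//; apply: XY.
by rewrite -[X in measurable X]setTI; exact: mg.
Qed.

Lemma ldn0 {d : measure_display} {T : measurableType d} {R : realType}
    {P : probability T R} {N : {RV P >-> R} -> \bar R} {X : {RV P >-> R}} :
  law_determined_norm N -> X =1 cst 0 -> N X = 0%E.
Proof.
move=> N_norm X0.
have -> : N X = N (cst 0 \* X).
  by congr N; apply/mfuneqP => w /=; rewrite X0 mul0r.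
by rewrite (ldn_homogeneous N_norm) normr0 mul0e.
Qed.

Lemma ldn_sum {d : measure_display} {T : measurableType d} {R : realType}
    {P : probability T R} {N : {RV P >-> R} -> \bar R} {m : nat}
    (Y : 'I_m -> {RV P >-> R}) :
  law_determined_norm N ->
  (N (\sum_(i < m) Y i)%R <= \sum_(i < m) N (Y i))%E.
Proof.
move=> N_norm; elim: m Y => [|m IHm] Y.
  by rewrite !big_ord0 (ldn0 N_norm).
rewrite !big_ord_recl (le_trans (ldn_triangle N_norm _ _))//.
by rewrite leeD2l.
Qed.

(** The functions [g] and [h] are arbitrary because only two facts matter: the
    norms of [g \o X] and [h \o X] are determined by [F], and complete
    mixability provides a coupling that lives on the hyperplane where [g] is
    controlled by [h]. *)
Lemma ldn_completely_mixable {d : measure_display} {T : measurableType d}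
    {R : realType} {P : probability T R} {m : nat}
    {F : probability (measurableTypeR R) R} {mu : R}
    {X gX hX : {RV P >-> R}} {N : {RV P >-> R} -> \bar R}
    {g h : R -> R} :
  completely_mixable P m.+1 F mu -> has_law X F -> law_determined_norm N ->
  measurable_fun setT g -> measurable_fun setT h ->
  gX =1 g \o X -> hX =1 h \o X ->
  (forall x, 0 <= g x) ->
  (forall x : 'I_m.+1 -> R, \sum_(i < m.+1) x i = m.+1%:R * mu ->
     g (x ord0) <= \sum_(i < m) h (x (lift ord0 i))) ->
  (N gX <= m%:R%:E * N hX)%E.
Proof.
move=> [Z [Z_F Z_sum]] X_F N_norm mg mh gXE hXE g_ge0 gh.
have ZX i : eq_law X (Z i) by move=> A mA; rewrite X_F// Z_F.
pose G := mfun_Sub (mem_set (measurableT_comp mg (measurable_funP (Z ord0)))).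
pose H i : {RV P >-> R} := mfun_Sub
  (mem_set (measurableT_comp mh (measurable_funP (Z (lift ord0 i))))).
have -> : N gX = N G by apply: (ldn_law N_norm); exact: (eq_law_comp mg (ZX ord0)).
have HE i : N (H i) = N hX.
  apply/esym/(ldn_law N_norm).
  exact: (eq_law_comp mh (ZX (lift ord0 i))).
have N_le : (N G <= N (\sum_(i < m) H i)%R)%E.
  apply: (ldn_monotone N_norm); apply: filterS Z_sum => w Zw.
  rewrite g_ge0/= mfun_sum; apply: (gh (fun i => Z i w)); exact: Zw.
rewrite (le_trans N_le)// (le_trans (ldn_sum _ N_norm))//.
under eq_bigr do rewrite HE.
by rewrite sumr_const card_ord mule_natl.
Qed.

Lemma max0_sum {R : realDomainType} {m : nat} (a : 'I_m -> R) :
  Num.max (\sum_(i < m) a i) 0 <= \sum_(i < m) Num.max (a i) 0.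
Proof.
rewrite ge_max sumr_ge0 ?andbT => [|i _]; last by rewrite le_max lexx orbT.
by apply: ler_sum => i _; rewrite le_max lexx.
Qed.

(** The hypothesis says that the constant vector [s] on the last [m] entries
    together with [t] in the first one also has sum [c], so that the deviations
    from this vector have sum zero. *)
Lemma sum_const_subE {R : comPzRingType} {m : nat} {x : 'I_m.+1 -> R}
    {s t c : R} :
  m%:R * s = c - t -> \sum_(i < m.+1) x i = c ->
  x ord0 - t = \sum_(i < m) - (x (lift ord0 i) - s).
Proof.
move=> ms; rewrite big_ord_recl => /(canRL (addrK _)) ->.
rewrite sumrN sumrB sumr_const card_ord -mulr_natl ms; ring.
Qed.

(* In X^\+ and X^\-, the library's positive and negative parts are
   max(X, 0) and max(- X, 0).  *)
Theorem theorem5 (d : measure_display) (T : measurableType d) (R : realType)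
    (P : probability T R) (P_atomless : atomless P)
    (n : nat) (n_ge2 : (2 <= n)%N)
    (F : probability (measurableTypeR R) R) (mu : R)
    (F_mixable : completely_mixable P n F mu)
    (X : {RV P >-> R}) (X_F : has_law X F)
    (N : {RV P >-> R} -> \bar R) (N_norm : law_determined_norm N)
    (t s : R) (s_def : s = (n%:R * mu - t) / (n%:R - 1)) :
  (N ((X \- cst t)^\+)%R <= (n%:R - 1)%R%:E * N ((X \- cst s)^\-)%R)%E /\
  (N ((X \- cst t)^\-)%R <= (n%:R - 1)%R%:E * N ((X \- cst s)^\+)%R)%E.
Proof.
case: n n_ge2 F_mixable s_def => // m m_gt0 F_mixable.
have -> : m.+1%:R - 1 = m%:R :> R by rewrite mulrSr addrK.
move=> s_def.
have ms : m%:R * s = m.+1%:R * mu - t.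
  by rewrite s_def mulrC divfK// pnatr_eq0 -lt0n.
have m_pos c : measurable_fun setT (fun x : R => x - c)^\+.
  by apply: measurable_funrpos; exact: measurable_funB.
have m_neg c : measurable_fun setT (fun x : R => x - c)^\-.
  by apply: measurable_funrneg; exact: measurable_funB.
split.
- apply: (ldn_completely_mixable F_mixable X_F N_norm (m_pos t) (m_neg s)) => //.
  move=> x /(sum_const_subE ms) xE.
  by rewrite /funrpos xE; exact: max0_sum.
- apply: (ldn_completely_mixable F_mixable X_F N_norm (m_neg t) (m_pos s)) => //.
  move=> x /(sum_const_subE ms) xE; rewrite /funrneg xE -sumrN.
  by under eq_bigr do rewrite opprK; exact: max0_sum.
Qed.
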